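(* Let $m,n$ be positive integers with $n\ge m-1$, and let $\lambda_1,\ldots,\lambda_{m+1}$ be any distinct parameters (e.g. distinct real numbers). Then the normalized volume of the partial permutohedron $\mathcal{P}(m,n)$ is given by $$v(m,n)=\sum_{\sigma\in\mathfrak{S}_{m+1}}\frac{\Bigl(\sum_{i=1}^{p_\sigma-1}(n-i+1)\,\lambda_{\sigma(i)}+\tfrac12\,(m-p_\sigma+1)(2n-m-p_\sigma+2)\,\lambda_{m+1}\Bigr)^m}{\prod_{i=1}^m(\lambda_{\sigma(i)}-\lambda_{\sigma(i+1)})},$$ where $p_\sigma=\sigma^{-1}(m+1)$.
   Context: For positive integers $m,n$, the partial permutohedron $\mathcal{P}(m,n)\subseteq\mathbb{R}^m$ is the convex hull of all vectors in $\{0,1,\ldots,n\}^m$ whose nonzero entries are distinct. Its normalized volume is $v(m,n)=m!\cdot\mathrm{Vol}(\mathcal{P}(m,n))$, with $\mathrm{Vol}$ Lebesgue measure on $\mathbb{R}^m$. $\mathfrak{S}_{m+1}$ is the set of permutations of $\{1,\ldots,m+1\}$. *)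

(* Defs.v *)
From HB Require Import structures.
From mathcomp Require Import all_boot all_order all_algebra all_fingroup.
From mathcomp Require Import all_classical all_reals all_analysis.

Set Implicit Arguments.
Unset Strict Implicit.
Unset Printing Implicit Defensive.

Import Order.TTheory GRing.Theory Num.Theory.
Import numFieldNormedType.Exports.

Local Open Scope classical_set_scope.
Local Open Scope ring_scope.

(* Lebesgue measure on R^n, as the n-fold product of the one-dimensional
   Lebesgue measure. It lives on the product sigma-algebra of n.-tuple R (the
   Borel sets), and R * R^n is identified with R^n.+1 through tuple_of_pair. *)
Section lebesgue_tuple.
Context {R : realType}.

Local Notation T := (measurableTypeR R).

Definition tuple_of_pair n (p : T * n.-tuple T) : n.+1.-tuple T :=
  [tuple of p.1 :: p.2].

Lemma measurable_tuple_of_pair n :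
  measurable_fun [set: T * n.-tuple T] (@tuple_of_pair n).
Proof. exact: measurable_cons. Qed.

Section step.
Variables (n : nat) (mu : {sigma_finite_measure set (n.-tuple T) -> \bar R}).

Definition lebesgue_cons : set (n.+1.-tuple T) -> \bar R :=
  pushforward (lebesgue_measure \x mu)%E (@tuple_of_pair n).

Let preimageT A : measurable A -> measurable (@tuple_of_pair n @^-1` A).
Proof.
by move=> mA; rewrite -[X in measurable X]setTI;
  exact: measurable_tuple_of_pair.
Qed.

Let lebesgue_cons0 : lebesgue_cons set0 = 0%E.
Proof. by rewrite /lebesgue_cons /pushforward preimage_set0 measure0. Qed.

Let lebesgue_cons_ge0 A : (0 <= lebesgue_cons A)%E.
Proof. by rewrite /lebesgue_cons /pushforward; exact: measure_ge0. Qed.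

Let lebesgue_cons_sigma_additive : semi_sigma_additive lebesgue_cons.
Proof.
move=> F mF tF mUF; rewrite /lebesgue_cons /pushforward preimage_bigcup.
apply: measure_semi_sigma_additive.
- by move=> k; exact: preimageT.
- apply/trivIsetP => /= i j _ _ ij; rewrite -preimage_setI.
  by move/trivIsetP : tF => /(_ _ _ _ _ ij) ->//; rewrite preimage_set0.
- by rewrite -preimage_bigcup; exact: preimageT.
Qed.

HB.instance Definition _ := isMeasure.Build _ _ _ lebesgue_cons
  lebesgue_cons0 lebesgue_cons_ge0 lebesgue_cons_sigma_additive.

Let lebesgue_cons_sigma_finite : sigma_finite setT lebesgue_cons.
Proof.
have /sigma_finiteP[F [TF ndF Foo]] := sigma_finiteT (@lebesgue_measure R).
have /sigma_finiteP[G [TG ndG Goo]] := sigma_finiteT mu.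
pose pair_of_tuple (t : n.+1.-tuple T) : T * n.-tuple T :=
  (thead t, [tuple of behead t]).
have mp : measurable_fun setT pair_of_tuple.
  apply/measurable_fun_pairP; split; first exact: measurable_tnth.
  exact: measurable_behead.
exists (fun k => pair_of_tuple @^-1` (F k `*` G k)).
  apply/esym/seteqP; split=> // t _.
  have [i _ Fi] : (\bigcup_i F i) (pair_of_tuple t).1 by rewrite -TF.
  have [j _ Gj] : (\bigcup_i G i) (pair_of_tuple t).2 by rewrite -TG.
  exists (maxn i j) => //; split.
    by apply: subsetPset Fi; exact/ndF/leq_maxl.
  by apply: subsetPset Gj; exact/ndG/leq_maxr.
move=> k; have [mFk Fkoo] := Foo k; have [mGk Gkoo] := Goo k; split.
  by rewrite -[X in measurable X]setTI; apply: mp => //; exact: measurableX.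
rewrite /lebesgue_cons /pushforward -comp_preimage.
have -> : pair_of_tuple \o @tuple_of_pair n = id.
  by apply/funext => -[x t]; congr (_, _); exact/val_inj.
by rewrite preimage_id product_measure1E// lte_mul_pinfty// ge0_fin_numE.
Qed.

HB.instance Definition _ := Measure_isSigmaFinite.Build _ _ _ lebesgue_cons
  lebesgue_cons_sigma_finite.

End step.

Fixpoint lebesgue_tuple n : {sigma_finite_measure set (n.-tuple T) -> \bar R} :=
  if n is n'.+1 then lebesgue_cons (lebesgue_tuple n')
  else \d_([tuple] : 0.-tuple T).

Lemma lebesgue_tuple_box n (A : 'I_n -> set T) :
  (forall i, measurable (A i)) ->
  lebesgue_tuple n [set t | forall i, A i (tnth t i)] =
  (\prod_(i < n) lebesgue_measure (A i))%E.
Proof.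
elim: n A => [|n IH] A mA.
  rewrite big_ord0 /= diracE mem_set// => -[]//.
rewrite big_ord_recl -IH//= /lebesgue_cons /pushforward.
rewrite -product_measure1E//; last first.
  rewrite [X in measurable X](_ : _ =
      \bigcap_(i in [set: 'I_n]) ((@tnth n T)^~ i @^-1` A (lift ord0 i))).
    apply: fin_bigcap_measurable => // i _.
    rewrite -[X in measurable X]setTI; exact: measurable_tnth.
  by apply/seteqP; split=> [t + i _|t + i]; apply.
congr (product_measure1 _ _ _); apply/seteqP; split=> -[x t] /=.
  move=> h; split; first exact: (h ord0).
  by move=> i; have := h (lift ord0 i); rewrite tnthS.
move=> [hx ht] i; case: (unliftP ord0 i) => [j|] -> //.
by rewrite tnthS; exact: ht.
Qed.

End lebesgue_tuple.

Definition volume {R : realType} m (A : set 'rV[R]_m) : \bar R :=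
  lebesgue_tuple m [set t | A (\row_i tnth t i)].

Definition convex_hull {R : realType} {E : lmodType R} (S : set E) : set E :=
  smallest (@convex_set R E) S.

Definition partial_permutohedron (R : realType) (m n : nat) : set 'rV[R]_m :=
  convex_hull [set x : 'rV[R]_m |
    (forall i, exists2 k : nat, (k <= n)%N & x 0 i = k%:R) /\
    (forall i j, x 0 i != 0 -> x 0 j != 0 -> i != j -> x 0 i != x 0 j)].

(* The partial permutohedron is compact, so that its volume is finite and
   fine does not lose information. *)
Definition normalized_volume (R : realType) (m n : nat) : R :=
  m`!%:R * fine (volume (@partial_permutohedron R m n)).

(* Main.v *)
Require Import Defs.
From HB Require Import structures.
From mathcomp Require Import all_boot all_order all_algebra all_fingroup.
From mathcomp Require Import all_classical all_reals all_analysis.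
From mathcomp Require Import measurable_realfun.
From mathcomp Require Import zify ring lra.

Set Implicit Arguments.
Unset Strict Implicit.
Unset Printing Implicit Defensive.

Import Order.TTheory GRing.Theory Num.Theory.

Local Open Scope ring_scope.

(** Write [f k] for [z 0 + ... + z (k-1)], with [z k = n - k] truncated at [0].
    The partial permutohedron is the polymatroid given by [x >= 0] and by
    [sum_{i in S} x i <= f #|S|] for every set [S] of coordinates
    ([partial_permutohedronE]).  Such polytopes are stable under slicing: for
    [0 <= t <= z 0] the slice [x 0 = t] is the polymatroid of
    [k |-> min (f k) (f k.+1 - t)] ([polymatroid_slice]).  When [t] runs from
    [z j.+1] to [z j], the sequence of the slice is [z] with its entries [j]
    and [j.+1] merged into [z j + z j.+1 - t], and the other entries do not
    depend on [t].

    This yields both halves of the geometry.  A vertex of the slice, with [t]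
    put in front, lies on a segment joining two vertices of the polymatroid, so
    by induction the inequalities imply membership in the convex hull
    ([polymatroid_sub_convex]).  And by Fubini the volume is the integral over
    [0, z 0] of the volume of the slices.

    For real parameters the volume formula follows by induction on the
    dimension ([volume_polymatroid]).  Put the parameter [a] of the first
    coordinate aside; a permutation of the remaining ones is a word [u].  On
    [z j.+1, z j] its contribution is the [m]-th power of an affine function of
    [t] of slope [a - u j], whose values at the two ends are the linear forms
    of the words obtained by inserting [a] in [u] at the positions [j] and
    [j.+1].  Integrating divides the difference of their powers of exponent
    [m.+1] by [a - u j]; summing over [j] by parts, the term of position [j]
    acquires the factor [1 / (a - u j) - 1 / (a - u j.-1)], which is exactly
    what turns the product of consecutive differences of [u] into that of the
    word with [a] inserted ([chain_insert], [perm_sumS]).  In the linear forms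
    and in the slopes, the letters after the last parameter are to be replaced
    by the last parameter, contrary to those products; [telescope_stop] shows
    that this does not change the sum.

    Finally, the right-hand side is a rational function of each parameter which
    is constant at infinitely many points, so that the parameters can be moved
    one at a time from the image of the reals to an arbitrary field
    ([perm_sum_transfer]). *)

(** * Polymatroids and their slices *)

(** A set of coordinates is encoded by its indicator function [b], which makes
    the removal of the first coordinate a mere [big_ord_recl]. *)
Definition polymatroid (R : realType) (m : nat) (z : nat -> R)
    (x : 'I_m -> R) : Prop :=
  (forall i, 0 <= x i) /\
  forall b : 'I_m -> bool,
    \sum_(i < m | b i) x i <= \sum_(k < \sum_(i < m) b i) z k.

(** With [f k] the sum of the first [k] entries of [z], these are the increments
    of [k |-> min (f k) (f k.+1 - t)], for [t <= z 0]; see [sum_slice]. *)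
Definition slice (R : realType) (z : nat -> R) (t : R) (k : nat) : R :=
  z k - Num.min (z k) t + Num.min (z k.+1) t.

Section slices.
Variable R : realType.
Implicit Types (z : nat -> R) (t : R).

Lemma slice_ge0 z t k : 0 <= t -> (forall i, 0 <= z i) -> 0 <= slice z t k.
Proof.
move=> t0 z0; rewrite /slice addr_ge0 ?subr_ge0 ?ge_min ?lexx//.
by rewrite le_min z0.
Qed.

Lemma slice_decr z t k : (forall i, z i.+1 <= z i) ->
  slice z t k.+1 <= slice z t k.
Proof.
move=> zd; rewrite /slice; have := zd k; have := zd k.+1.
by case: (lerP (z k) t); case: (lerP (z k.+1) t); case: (lerP (z k.+2) t);
  lra.
Qed.

(** Slicing at [t] between two consecutive entries merges these two entries. *)
Lemma slice_inE z t j i : (forall i, z i.+1 <= z i) ->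
  z j.+1 <= t <= z j ->
  slice z t i = if (i < j)%N then z i else
                if i == j then z j + z j.+1 - t else z i.+1.
Proof.
move=> zd /andP[tj jt].
have zmono: {homo z : i j / (i <= j)%N >-> j <= i}.
  by move/nonincreasing_seqP : zd => zd a b /zd.


rewrite /slice; case: ltngtP => [ij|ji|->].
- by rewrite !min_r ?subrK// (le_trans jt)// zmono// ltnW.
- by rewrite !min_l ?subrr ?add0r// (le_trans _ tj)// zmono// ltnW.
- by rewrite min_r// min_l// addrAC.
Qed.

Lemma sum_slice z t k : t <= z 0%N ->
  \sum_(j < k) slice z t j = \sum_(j < k) z j + Num.min (z k) t - t.
Proof.
move=> tz; elim: k => [|k IH]; first by rewrite !big_ord0 min_r// add0r subrr.
by rewrite !big_ord_recr/= IH /slice; lra.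
Qed.

Lemma sum_ord_rec0 m (b : 'I_m.+1 -> bool) (x : 'I_m.+1 -> R) :
  \sum_(i < m.+1 | b i) x i =
  (if b ord0 then x ord0 else 0) + \sum_(i < m | b (lift ord0 i)) x (lift ord0 i).
Proof. by rewrite big_mkcond big_ord_recl -big_mkcond. Qed.

Lemma card_ord_rec0 m (b : 'I_m.+1 -> bool) :
  (\sum_(i < m.+1) b i = b ord0 + \sum_(i < m) b (lift ord0 i))%N.
Proof. by rewrite big_ord_recl. Qed.

(** A set of the remaining coordinates can be taken with or without the first
    one, which bounds its sum by [f k.+1 - t] and by [f k]. *)
Lemma polymatroid_slice m z (x : 'I_m.+1 -> R) : (forall i, 0 <= z i) ->
  polymatroid z x <->
  0 <= x ord0 <= z 0%N /\ polymatroid (slice z (x ord0)) (x \o lift ord0).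
Proof.
move=> z0; pose ext e (b : 'I_m -> bool) i :=
  if unlift ord0 i is Some j then b j else e.
have extE e b : (ext e b ord0 = e) * (forall i, ext e b (lift ord0 i) = b i).
  by split=> [|i]; rewrite /ext ?unlift_none ?liftK.
split=> [[x0 xz]|[/andP[x0 xz] [y0 yz]]].
- have x0z : x ord0 <= z 0%N.
    have := xz (ext true (fun=> false)); rewrite sum_ord_rec0 card_ord_rec0.
    rewrite !extE big1; last by move=> i; rewrite !extE.
    rewrite (_ : (_ + _)%N = 1%N) ?big_ord1 ?addr0//.
    by rewrite big1// => i _; rewrite extE.
  rewrite x0 x0z; split=> //; split=> [i|b]; first exact: x0.
  rewrite sum_slice//.
  have bE : (\sum_(i < m) b i = \sum_(i < m) ext false b (lift ord0 i))%N.
    by apply: eq_bigr => i _; rewrite !extE.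
  have bE' : (\sum_(i < m) b i = \sum_(i < m) ext true b (lift ord0 i))%N.
    by apply: eq_bigr => i _; rewrite !extE.
  have sE e : \sum_(i < m | b i) (x \o lift ord0) i =
      \sum_(i < m | ext e b (lift ord0 i)) x (lift ord0 i).
    by apply: eq_bigl => i; rewrite !extE.
  have := xz (ext false b); rewrite sum_ord_rec0 card_ord_rec0 !extE -bE -sE.
  have := xz (ext true b); rewrite sum_ord_rec0 card_ord_rec0 !extE -bE' -sE.
  rewrite add0n add1n big_ord_recr/= add0r.
  by case: (lerP (z _) (x ord0)); lra.
- split=> [i|b].
    by case: (unliftP ord0 i) => [j|] ->//; exact: y0.
  have := yz (b \o lift ord0); rewrite sum_slice//= => h.
  rewrite sum_ord_rec0 card_ord_rec0; case: (b ord0).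
    rewrite add1n big_ord_recr/=; move: h.
    by case: (lerP (z _) (x ord0)); lra.
  rewrite add0n add0r; move: h.
  by case: (lerP (z _) (x ord0)); lra.
Qed.

End slices.

(** * The convex hull *)

Section hull.
Variable R : realType.
Implicit Types (z : nat -> R) (t : R).

Lemma convex_setP (E : lmodType R) (C : set E) : convex_set C <->
  forall x y (k : R), 0 <= k <= 1 -> C x -> C y -> C (k *: x + (1 - k) *: y).
Proof.
split=> [cC x y k /andP[k0 k1] Cx Cy|cC x y k].
  have kP : Itv.spec (@Itv.num_sem R) (Itv.Real `[0%Z, 1%Z]) k.
    by apply/and3P; split; rewrite ?bnd_simp ?num_real//=.
  have := cC x y (Itv.mk kP); rewrite !inE => /(_ Cx Cy).
  by rewrite /conv/=.
by rewrite !inE => Cx Cy; apply: cC => //; rewrite ge0 le1.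
Qed.

Definition vertex m z (k : nat) (s : 'S_m) : 'rV[R]_m :=
  \row_i if (s i < k)%N then z (s i) else 0.

(** By induction on the dimension, it is enough to reach [t] followed by a
    vertex of the slice.  If [t <= z k] that point lies between the vertices
    with first coordinate [0] and [z k].  Otherwise [t] lies between some
    [z j.+1] and [z j] with [j < k], the merged entry [z j + z j.+1 - t] occurs
    in the vertex, and the point lies between the two vertices where [z j] and
    [z j.+1] occupy these two places in either order. *)
Lemma polymatroid_sub_convex m z (C : set 'rV[R]_m) :
  (forall i, z i.+1 <= z i) -> (forall i, 0 <= z i) -> convex_set C ->
  (forall k s, (k <= m)%N -> C (vertex z k s)) ->
  forall x : 'rV[R]_m, polymatroid z (x 0) -> C x.
Proof.
elim: m z C => [|m IH] z C zd z0 /convex_setP cC vC x.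
  have -> : x = vertex z 0%N 1%g by apply/rowP => -[].
  by move=> _; exact: vC.
move=> /(polymatroid_slice _ z0)[/andP[x0 xz] Px].
set t := x 0 ord0 in x0 xz Px *.
pose cons (y : 'rV[R]_m) : 'rV[R]_m.+1 :=
  \row_i if unlift ord0 i is Some j then y 0 j else t.
pose C' : set 'rV[R]_m := fun y => C (cons y).
have -> : x = cons (\row_i x 0 (lift ord0 i)).
  by apply/rowP => i; rewrite !mxE; case: unliftP => [j|] ->; rewrite ?mxE.
apply: (IH (slice z t) C').
- by move=> i; exact: slice_decr.
- by move=> i; exact: slice_ge0.
- apply/convex_setP => u v k k01 Cu Cv; rewrite /C'/=.
  rewrite (_ : cons _ = k *: cons u + (1 - k) *: cons v); first exact: cC.
  apply/rowP => i; rewrite !mxE; case: unliftP => [j|] _; rewrite ?mxE//.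
  by lra.
- move=> k s km; rewrite /C'/=.
  have seg (u v : R) : v <= t <= u ->
      exists2 l, 0 <= l <= 1 & t = l * u + (1 - l) * v.
    case/andP => vt tu; have [uv|uv] := eqVneq u v.
      by exists 1; [rewrite lexx ler01 | lra].
    have uv0 : 0 < u - v by rewrite subr_gt0 lt_neqAle eq_sym uv (le_trans vt).
    exists ((t - v) / (u - v)).
      apply/andP; split; first by apply: divr_ge0 (ltW uv0); rewrite subr_ge0.
      by rewrite ler_pdivrMr// mul1r lerD2r.
    by field; rewrite subr_eq0.
  have vE (j : 'I_m.+1) k' i : vertex z k' (lift_perm ord0 j s) 0 i =
      let k0 := if unlift ord0 i is Some i' then bump j (s i') else j in
      if (k0 < k')%N then z k0 else 0.
    rewrite mxE; case: unliftP => [i'|] ->.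
      by rewrite lift_perm_lift.
    by rewrite lift_perm_id.
  have [tz|zt] := leP t (z k).
    have [l l01 tE] := seg _ _ (introT andP (conj x0 tz)).
    have kord : (k < m.+1)%N by [].
    pose k' := Ordinal kord.
    rewrite (_ : cons _ = l *: vertex z k.+1 (lift_perm ord0 k' s)
      + (1 - l) *: vertex z k (lift_perm ord0 k' s)).
      by apply: cC => //; apply: vC => //; rewrite ltnW.
    apply/rowP => i; rewrite [LHS]mxE [RHS]mxE [X in _ = X + _]mxE.
    rewrite [X in _ = _ + X]mxE !vE/=.
    case: unliftP => [i'|] _ /=; last by rewrite ltnSn ltnn.
    rewrite mxE /bump.
    have zmono: {homo z : i j / (i <= j)%N >-> j <= i}.
      by move/nonincreasing_seqP : zd => zd a b /zd.
    case: leqP => [ki|ik].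
      by rewrite add1n !ltnNge !(leqW, ltnS) ?ki//= !mulr0 addr0.
    rewrite add0n ik (leqW ik)/= /slice !min_r.
    + by lra.
    + by rewrite (le_trans tz)// zmono.
    + by rewrite (le_trans tz)// zmono// ltnW.
  have [j jk /andP[tj jt]] : exists2 j, (j < k)%N & z j.+1 <= t <= z j.
    elim: (k) zt => [|k' IHk] zt; first by move: xz; rewrite leNgt zt.
    have [tz'|zt'] := leP t (z k'); first by exists k' => //; rewrite ltW.
    by have [j jk jz] := IHk zt'; exists j => //; rewrite ltnS ltnW.
  have [l l01 tE] := seg _ _ (introT andP (conj tj jt)).
  have jm : (j < m.+1)%N by rewrite ltnS (leq_trans (ltnW jk)).
  have j1m : (j.+1 < m.+1)%N by rewrite ltnS (leq_trans jk).
  rewrite (_ : cons _ = l *: vertex z k.+1 (lift_perm ord0 (Ordinal jm) s)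
      + (1 - l) *: vertex z k.+1 (lift_perm ord0 (Ordinal j1m) s)).
    by apply: cC => //; apply: vC.
  apply/rowP => i; rewrite [LHS]mxE [RHS]mxE [X in _ = X + _]mxE.
  rewrite [X in _ = _ + X]mxE !vE/=.
  case: unliftP => [i'|] _ /=; last by rewrite !ltnS jk (ltnW jk).
  rewrite mxE (@slice_inE _ _ _ j)// ?tj//.
  rewrite /bump; case: (ltngtP (s i') j) => ij /=; rewrite ?add0n ?add1n ?ltnS.
  - by rewrite (ltn_trans ij jk) (ltnW (ltn_trans ij jk)); ring.
  - by case: ifP => _; ring.
  - by rewrite ij jk (ltnW jk) {1}tE; lra.
- by case: Px => h1 h2; split=> [i|b];
    [rewrite mxE; exact: h1 | under eq_bigr do rewrite mxE; exact: h2].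
Qed.

(** By induction on [n > 0]: at most one of the numbers equals [n], and removing
    it leaves numbers bounded by [n.-1]. *)
Lemma sum_distinct_le m n (b : pred 'I_m) (k : 'I_m -> nat) :
  (forall i, b i -> (k i <= n)%N) ->
  (forall i j, b i -> b j -> k i != 0%N -> k i = k j -> i = j) ->
  (\sum_(i < m | b i) k i <= \sum_(j < \sum_(i < m) b i) (n - j))%N.
Proof.
elim: n b => [|n IH] b kn kinj.
  by rewrite big1// => i /kn; rewrite leqn0 => /eqP.
have [i0 /andP[bi0 /eqP ki0]|nb] := pickP (fun i => b i && (k i == n.+1)).
  rewrite (bigD1 i0)//= (bigD1 i0 (P := xpredT))//= bi0 add1n big_ord_recl ki0.
  rewrite subn0 leq_add2l.
  have -> : (\sum_(i < m | i != i0) b i =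
             \sum_(i < m) (b i && (i != i0)))%N.
    by rewrite big_mkcond; apply: eq_bigr => i _; case: (b i); case: (i != i0).
  apply: (IH [pred i | b i & i != i0]) => /= [i /andP[bi ii0]|i j].
    have := kn _ bi; rewrite leq_eqVlt ltnS => /predU1P[ki|//].
    by case/eqP: ii0; apply: kinj; rewrite ?ki ?ki0.
  by move=> /andP[bi _] /andP[bj _]; exact: kinj.
apply: leq_trans (IH b _ kinj) _ => [i bi|]; last first.
  by apply: leq_sum => i _; lia.
by have := kn _ bi; have := nb i; rewrite bi/= leq_eqVlt ltnS => ->.
Qed.

Lemma partial_permutohedronE m n : @partial_permutohedron R m n =
  [set x | polymatroid (fun k => (n - k)%N%:R) (x 0)]%classic.
Proof.
apply/seteqP; split.
  apply: smallest_sub.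
    apply/convex_setP => u v k /andP[k0 k1] [u0 uz] [v0 vz]; split=> [i|b].
      by rewrite !mxE addr_ge0// mulr_ge0// subr_ge0.
    rewrite (eq_bigr (fun i => k * u 0 i + (1 - k) * v 0 i)); last first.
      by move=> i _; rewrite !mxE.
    rewrite big_split/= -!mulr_sumr.
    set s := (X in _ <= X).
    have -> : s = k * s + (1 - k) * s by ring.
    by apply: lerD; apply: ler_wpM2l; rewrite ?subr_ge0.
  move=> x/= [xn xd]; split=> [i|b].
    by have [k _ ->] := xn i.
  have /choice[k kP] : forall i, exists k, (k <= n)%N /\ x 0 i = k%:R.
    by move=> i; have [k kn xk] := xn i; exists k.
  under eq_bigr do rewrite (kP _).2.
  rewrite -!natr_sum ler_nat; apply: sum_distinct_le => [i _|i j _ _ ki kij].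
    exact: (kP i).1.
  apply/eqP; apply: contraT => ij.
  have := xd i j; rewrite !(kP _).2 -kij pnatr_eq0 eqxx.
  by move=> /(_ ki ki ij).
move=> x Px C [cC SC].
apply: (polymatroid_sub_convex _ _ cC _ Px) => [i|i|k s km].
- by rewrite ler_nat; lia.
- by [].
apply: SC; split=> [i|i j]; rewrite !mxE.
  by case: ifP => _; [exists (n - s i)%N; rewrite ?leq_subr | exists 0%N].
case: ifP => _; rewrite ?eqxx// pnatr_eq0; case: ifP => _; rewrite ?eqxx//.
rewrite pnatr_eq0 eqr_nat => si sj ij; apply: contra ij => /eqP sij.
by apply/eqP/(@perm_inj _ s)/val_inj => /=; lia.
Qed.

End hull.

(** * Sums over permutations *)

Definition word (F : Type) (n : nat) (lam : 'I_n.+1 -> F) (s : 'S_n.+1)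
    (k : nat) : F := lam (s (inord k)).

Definition last_pos (n : nat) (s : 'S_n.+1) : nat := (s^-1)%g ord_max.

(** All weights from the position [p] of the special letter on multiply that
    letter, so a word contributes through its sequence frozen at [p]. *)
Definition stop (F : Type) (p : nat) (u : nat -> F) (k : nat) : F :=
  u (minn k p).

Definition insert (F : Type) (j : nat) (a : F) (u : nat -> F) (k : nat) : F :=
  if (k < j)%N then u k else if k == j then a else u k.-1.

Definition chain (F : comNzRingType) (m : nat) (u : nat -> F) : F :=
  \prod_(i < m) (u i - u i.+1).

(** The translation [c] is there for the induction: a slice at [t] contributes
    an additional constant, affine in [t], to each linear form. *)
Definition perm_sum (F : fieldType) (m : nat) (z : nat -> F) (c : F)
    (lam : 'I_m.+1 -> F) : F :=
  \sum_(s : 'S_m.+1)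
    (c + \sum_(i < m) z i * stop (last_pos s) (word lam s) i) ^+ m /
    chain m (word lam s).

Section insertion.
Variable F : fieldType.
Implicit Types (u z A : nat -> F) (a c : F).

Lemma last_pos_lt n (s : 'S_n.+1) : (last_pos s <= n)%N.
Proof. by rewrite -ltnS; exact: ltn_ord. Qed.

Lemma word_inj n (lam : 'I_n.+1 -> F) s k l : injective lam ->
  (k <= n)%N -> (l <= n)%N -> word lam s k = word lam s l -> k = l.
Proof.
move=> lam_inj kn ln /lam_inj/perm_inj/(congr1 val)/=.
by rewrite !inordK.
Qed.

Lemma word_lift_perm n (lam : 'I_n.+2 -> F) j (s : 'S_n.+1) k : (k <= n.+1)%N ->
  word lam (lift_perm j ord0 s) k =
  insert j (lam ord0) (word (lam \o lift ord0) s) k.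
Proof.
move=> kn; rewrite /word /insert.
have kE : nat_of_ord (inord k : 'I_n.+2) = k by rewrite inordK.
case: (unliftP j (inord k)) => [i|] jE.
  rewrite jE lift_perm_lift; move: kE; rewrite jE/= => <-.
  rewrite /bump; case: (leqP j i) => ji; rewrite ?add0n ?add1n/=.
    by rewrite ltnNge leqW//= gtn_eqF// inord_val.
  by rewrite ji inord_val.
by rewrite jE lift_perm_id; move: kE; rewrite jE => <-; rewrite ltnn eqxx.
Qed.

Lemma last_pos_lift_perm n j (s : 'S_n.+1) :
  last_pos (lift_perm j ord0 s : 'S_n.+2) = bump j (last_pos s).
Proof.
rewrite /last_pos; suff -> : ((lift_perm j ord0 s)^-1)%g ord_max =
  lift j ((s^-1)%g ord_max) by [].
apply: (@perm_inj _ (lift_perm j ord0 s)).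
by rewrite permKV lift_perm_lift permKV; exact/val_inj.
Qed.

(** A permutation amounts to the place [j] where it takes the value [0] and a
    permutation of the other values. *)
Lemma sum_lift_perm n (f : 'S_n.+1 -> F) :
  \sum_(s : 'S_n.+1) f s =
  \sum_(j < n.+1) \sum_(t : 'S_n) f (lift_perm j ord0 t).
Proof.
rewrite (partition_big (fun s : 'S_n.+1 => (s^-1)%g ord0) xpredT)//=.
apply: eq_bigr => j _.
rewrite (reindex (lift_perm j ord0)); last first.
  pose g (s : 'S_n.+1) i := odflt i (unlift ord0 (s (lift j i))).
  have gK (s : 'S_n.+1) : s j = ord0 ->
      forall i, lift ord0 (g s i) = s (lift j i).
    move=> sj i; rewrite /g; case: unliftP => //= s0.
    have : s (lift j i) = s j by rewrite s0 sj.
    by move/perm_inj => /eqP; rewrite eq_sym (negbTE (neq_lift _ _)).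
  have ginj (s : 'S_n.+1) : s j = ord0 -> injective (g s).
    move=> sj i1 i2 /(congr1 (lift ord0)); rewrite !gK//.
    by move/perm_inj/lift_inj.
  pose h (s : 'S_n.+1) : 'S_n :=
    if pselect (s j = ord0) is left sj then perm (ginj s sj) else 1%g.
  exists h => s.
    move=> _; rewrite /h; case: pselect => [sj|]; last by rewrite lift_perm_id.
    apply/permP => i; rewrite permE.
    by apply: (@lift_inj _ ord0); rewrite gK// lift_perm_lift.
  rewrite inE => /eqP sj.
  have sj0 : s j = ord0 by rewrite -sj permKV.
  apply/permP => i; rewrite /h; case: pselect => // sj'.
  case: (unliftP j i) => [k|] ->; last by rewrite lift_perm_id.
  by rewrite lift_perm_lift permE gK.
apply: eq_bigl => s; apply/eqP.
by apply: (@perm_inj _ (lift_perm j ord0 s)); rewrite permKV lift_perm_id.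
Qed.

Lemma stop_insert j p a u i :
  stop (bump j p) (insert j a u) i =
  if (j <= p)%N then insert j a (stop p u) i else stop p u i.
Proof.
rewrite /stop /insert /bump; case: (leqP j p) => jp.
  rewrite add1n; case: (leqP i p.+1) => ip.
    case: ltngtP => // ij; congr u; first by apply/esym/minn_idPl; lia.
    by apply/esym/minn_idPl; lia.
  rewrite ltnNge (leq_trans jp (leqnSn p))/= gtn_eqF ?ltnS//.
  rewrite ltnNge (_ : j <= i)%N/=; last by lia.
  by rewrite gtn_eqF; [congr u; lia | lia].
by rewrite add0n (leq_ltn_trans (geq_minr _ _) jp).
Qed.

Lemma chainS m u : chain m.+1 u = (u 0%N - u 1%N) * chain m (u \o succn).
Proof. by rewrite /chain big_ord_recl. Qed.

Lemma eq_chain m u v : (forall k, (k <= m)%N -> u k = v k) ->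
  chain m u = chain m v.
Proof.
by move=> uv; apply: eq_bigr => i _; rewrite !uv// ltnW.
Qed.

(** Between two letters [b] and [d] this is the identity
    [1 / (a - d) - 1 / (a - b) = (b - d) / ((b - a) (a - d))]; at either end of
    the word only one neighbour, hence only one of the two fractions, is left. *)
Lemma chain_insert m j a u : (j <= m.+1)%N ->
  (forall k, (k <= m)%N -> a != u k) ->
  (forall k, (k < m)%N -> u k != u k.+1) ->
  (chain m.+1 (insert j a u))^-1 =
  ((if (j <= m)%N then (a - u j)^-1 else 0) -
   (if j is i.+1 then (a - u i)^-1 else 0)) / chain m u.
Proof.
elim: m j u => [|m IH] [|[|j]] u //= jm au uu.
- by rewrite /chain big_ord1 big_ord0 divr1 subr0.
- by rewrite /chain big_ord1 big_ord0 divr1 sub0r /insert/= -invrN opprB.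
- by rewrite chainS invfM subr0.
- rewrite !chainS/=.
  rewrite (@eq_chain m _ (u \o succn))//.
  have := au 0%N isT; have := au 1%N isT; have := uu 0%N isT.
  rewrite /insert/= => u01 a1 a0.
  have [->|cu] := eqVneq (chain m (u \o succn)) 0.
    by rewrite !mulr0 invr0 mulr0.
  by field; rewrite cu !subr_eq0 u01 a1 a0 eq_sym.
- have := IH j.+1 (u \o succn) jm (fun k km => au k.+1 km)
                                   (fun k km => uu k.+1 km).
  rewrite [LHS]/= => IHj.
  rewrite chainS (@eq_chain m.+1 _ (insert j.+1 a (u \o succn))).
    by rewrite invfM IHj chainS/= invfM /insert/= ltnS; ring.
  by move=> [|k] km.
Qed.

(** Summation by parts of [chain_insert]. *)
Lemma sum_insert m a u (B : nat -> F) :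
  (forall k, (k <= m)%N -> a != u k) ->
  (forall k, (k < m)%N -> u k != u k.+1) ->
  \sum_(j < m.+2) B j / chain m.+1 (insert j a u) =
  \sum_(j < m.+1) (B j - B j.+1) / (a - u j) / chain m u.
Proof.
move=> au uu.
transitivity (\sum_(j < m.+2)
    (B j * (if (j <= m)%N then (a - u j)^-1 else 0) / chain m u -
     B j * (if nat_of_ord j is i.+1 then (a - u i)^-1 else 0) / chain m u)).
  apply: eq_bigr => j _; rewrite chain_insert//; last by rewrite -ltnS.
  by rewrite mulrA mulrBr mulrBl.
rewrite sumrB big_ord_recr/= ltnn mulr0 mul0r addr0.
rewrite [X in _ - X]big_ord_recl/= mulr0 mul0r add0r -sumrB.
apply: eq_bigr => j _; rewrite -ltnS ltn_ord /bump/= add1n.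
by rewrite !mulrBl.
Qed.

(** From the position [p] of the special letter on the slopes are all
    [a - u p] on the left, so that the terms telescope to
    [(A p - A m.+1) / (a - u p)]; on the right the term [j = p] has this same
    value and the later ones vanish. *)
Lemma telescope_stop m p a u A : (p <= m)%N ->
  \sum_(j < m.+1) (A j - A j.+1) / (a - stop p u j) =
  \sum_(j < m.+1) ((if (j <= p)%N then A j else A m.+1) -
                   (if (j < p)%N then A j.+1 else A m.+1)) / (a - u j).
Proof.
move=> pm; apply/eqP; rewrite -subr_eq0 -sumrB.
suff H k : \sum_(j < k) ((A j - A j.+1) / (a - stop p u j) -
    ((if (j <= p)%N then A j else A m.+1) -
     (if (j < p)%N then A j.+1 else A m.+1)) / (a - u j)) =
    if (k <= p)%N then 0 else (A m.+1 - A k) / (a - u p).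
  by rewrite H leqNgt ltnS pm/= subrr mul0r.
elim: k => [|k IH]; first by rewrite big_ord0.
rewrite big_ord_recr/= IH /stop; case: (ltngtP k p) => kp.
- by rewrite subrr addr0.
- by ring.
- by rewrite kp; ring.
Qed.

(** If [z n = 0], the linear form of [u] with the letter [a] inserted at position
    [j] ([weight_insert]), with the contribution of [a] set apart. *)
Definition weight (n : nat) z a u (j : nat) : F :=
  z j * a + \sum_(i < n) z (bump j i) * u i.

Lemma weight_insert n z a u j : (j <= n)%N -> z n = 0 ->
  weight n z a u j = \sum_(i < n) z i * insert j a u i.
Proof.
move=> jn zn; transitivity (\sum_(i < n.+1) z i * insert j a u i); last first.
  by rewrite big_ord_recr/= zn mul0r addr0.
have jn1 : (j < n.+1)%N by [].
rewrite (bigD1_ord (Ordinal jn1))//= {1}/insert ltnn eqxx; congr (_ + _).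
apply: eq_bigr => i _; rewrite /insert /bump; case: (leqP j i) => ji.
  by rewrite add1n ltnNge leqW//= gtn_eqF.
by rewrite add0n ji.
Qed.

Lemma weight_stop n z a u : z n = 0 ->
  weight n z a u n = \sum_(i < n) z i * u i.
Proof.
move=> zn; rewrite /weight zn mul0r add0r; apply: eq_bigr => i _.
by rewrite /bump leqNgt ltn_ord.
Qed.

Lemma weightS n z a u j : (j < n)%N ->
  weight n z a u j.+1 = weight n z a u j + (z j.+1 - z j) * (a - u j).
Proof.
move=> jn; rewrite /weight (bigD1 (Ordinal jn))//=.
rewrite [in RHS](bigD1 (Ordinal jn))//=.
rewrite (eq_bigr (fun i : 'I_n => z (bump j i) * u i)) => [|i ij].
  by rewrite /bump leqnn ltnn add1n add0n; ring.
by rewrite /bump (ltn_neqAle j i) eq_sym -val_eqE/= in ij *; rewrite ij.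
Qed.

(** The right-hand side is what the slicing produces: up to a constant factor,
    the term of index [j] is the integral over [z j.+1, z j]. *)
Lemma perm_sumS m z c (lam : 'I_m.+2 -> F) : injective lam -> z m.+1 = 0 ->
  perm_sum z c lam =
  \sum_(s : 'S_m.+1)
    let w := word (lam \o lift ord0) s in
    let u := stop (last_pos s) w in
    let A := weight m.+1 z (lam ord0) u in
    (\sum_(j < m.+1) ((c + A j) ^+ m.+1 - (c + A j.+1) ^+ m.+1) /
      (lam ord0 - u j)) / chain m w.
Proof.
move=> lam_inj zm; rewrite /perm_sum sum_lift_perm exchange_big/=.
apply: eq_bigr => s _.
set w := word _ s; set p := last_pos s; set u := stop p w.
set A := weight _ _ _ _; pose A' j := (c + A j) ^+ m.+1.
have pm : (p <= m)%N by exact: last_pos_lt.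
have lam'_inj : injective (lam \o lift ord0).
  by move=> i j /lam_inj/lift_inj.
have aw k : lam ord0 != w k.
  by apply/eqP => /lam_inj/eqP; rewrite (negbTE (neq_lift _ _)).
have ww k : (k < m)%N -> w k != w k.+1.
  move=> km; apply/eqP => /(word_inj lam'_inj (ltnW km) km)/eqP.
  by rewrite ltn_eqF.
pose B (j : nat) := if (j <= p)%N then A' j else A' m.+1.
transitivity (\sum_(j < m.+2) B j / chain m.+1 (insert j (lam ord0) w)).
  apply: eq_bigr => j _; have jm : (j <= m.+1)%N by rewrite -ltnS.
  rewrite (eq_chain (v := insert j (lam ord0) w)) => [|k km]; last first.
    exact: word_lift_perm.
  congr (_ / _); rewrite last_pos_lift_perm.
  transitivity ((c + \sum_(i < m.+1) z i *
      (if (j <= p)%N then insert j (lam ord0) u i else u i)) ^+ m.+1).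
    congr ((_ + _) ^+ _); apply: eq_bigr => i _; rewrite -stop_insert.
    rewrite /stop word_lift_perm//.
    by rewrite (leq_trans (geq_minl _ _))// ltnW.
  rewrite /B /A'; case: ifP => jp.
    by rewrite -weight_insert.
  by rewrite /A weight_stop.
rewrite sum_insert// -mulr_suml; congr (_ / _).
by rewrite (telescope_stop _ _ A').
Qed.

Lemma eq_perm_sum m z z' c (lam : 'I_m.+1 -> F) :
  (forall k, (k < m)%N -> z k = z' k) -> perm_sum z c lam = perm_sum z' c lam.
Proof.
move=> zz'; apply: eq_bigr => s _; congr ((_ + _) ^+ _ / _).
by apply: eq_bigr => i _; rewrite zz'.
Qed.

End insertion.

(** * Volumes of polymatroids *)

Section volume.
Import numFieldNormedType.Exports.
Local Open Scope classical_set_scope.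
Local Open Scope ring_scope.
Variable R : realType.
Implicit Types (z : nat -> R) (t : R).

Let mu := @lebesgue_measure R.

Lemma integral_deriv (p : {poly R}) (a b : R) : a <= b ->
  (\int[mu]_(t in `[a, b]%classic) (p^`().[t])%:E = (p.[b] - p.[a])%:E)%E.
Proof.
rewrite le_eqVlt => /predU1P[->|ab].
  by rewrite set_itv1 integral_set1 subrr.
have cp (q : {poly R}) : continuous (horner q) by exact: continuous_horner.
rewrite (@continuous_FTC2 _ _ (horner p))//.
- exact/continuous_subspaceT/cp.
- split => [x _||].
  + exact: derivable_horner.
  + exact: cvg_at_right_filter (cp p a).
  + exact: cvg_at_left_filter (cp p b).
- by move=> x _; rewrite derivE.
Qed.

Lemma integral_pieces (G : R -> R) z (q : nat -> {poly R}) k :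
  (forall i, z i.+1 <= z i) ->
  (forall j t, (j < k)%N -> z j.+1 <= t <= z j -> G t = (q j)^`().[t]) ->
  measurable_fun `[z k, z 0%N]%classic
    G /\
  (\int[mu]_(t in `[z k, z 0%N]%classic) (G t)%:E =
   (\sum_(j < k) ((q j).[z j] - (q j).[z j.+1]))%:E)%E.
Proof.
move=> zd; elim: k => [|k IH] Gq.
  rewrite set_itv1 integral_set1 big_ord0; split=> //.
  exact: measurable_fun_set1.
have [mG iG] := IH (fun j t jk => Gq j t (ltnW jk)).
have z0k : z k <= z 0%N by move/nonincreasing_seqP : zd; exact.
have Gk t : t \in (`[z k.+1, z k]%classic : set R) ->
    (q k)^`().[t] = G t.
  by rewrite inE/= in_itv/= => zt; rewrite (Gq k).
have mGk : measurable_fun `[z k.+1, z k]%classic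
    G.
  apply: eq_measurable_fun Gk _; exact: measurable_poly.
have mGk' : measurable_fun `]z k, z 0%N]%classic
    G.
  by apply: measurable_funS mG => //; exact: subset_itv_oc_cc.
have -> : `[z k.+1, z 0%N]%classic =
    (`[z k.+1, z k] `|` `]z k, z 0%N])%classic :> set R.
  by rewrite -itv_bndbnd_setU// bnd_simp.
have mGU : measurable_fun (`[z k.+1, z k] `|` `]z k, z 0%N])%classic G.
  by apply/measurable_funU.
split=> //.
rewrite integral_setU//=; last first.
- apply/disj_setPRL => t/=; rewrite !in_itv/= => /andP[kt _] /andP[_].
  by rewrite leNgt kt.
- exact/measurable_EFinP.
rewrite integral_itv_obnd_cbnd//; last exact/measurable_EFinP.
have -> : (\int[lebesgue_measure]_(t in `[z k.+1, z k]%classic) (G t)%:E =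
    ((q k).[z k] - (q k).[z k.+1])%:E)%E.
  by rewrite -integral_deriv//; apply: eq_integral => t /Gk <-.
by rewrite iG big_ord_recr/= addrC.
Qed.


(** Cavalieri's principle. *)
Lemma lebesgue_tupleS m (A : set (m.+1.-tuple (measurableTypeR R))) :
  lebesgue_tuple m.+1 A =
  (\int[mu]_x lebesgue_tuple m [set y | A (tuple_of_pair (x, y))])%E.
Proof.
rewrite /= /lebesgue_cons /pushforward /product_measure1.
apply: eq_integral => x _ /=; congr (lebesgue_tuple m _).
by apply/seteqP; split=> y; rewrite /xsection/= inE.
Qed.

Lemma eq_polymatroid m z z' (x : 'I_m -> R) :
  (forall k, (k < m)%N -> z k = z' k) -> polymatroid z x -> polymatroid z' x.
Proof.
move=> zz' [x0 xz]; split=> // b; apply: le_trans (xz b) _.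
rewrite le_eqVlt; apply/orP; left; apply/eqP/eq_bigr => i _; apply: zz'.
apply: leq_trans (ltn_ord i) _; rewrite -[X in (_ <= X)%N]card_ord -sum1_card.
by apply: leq_sum => j _; case: (b j).
Qed.

Lemma slice_bump z t j i : (forall i, z i.+1 <= z i) -> z j.+1 <= t <= z j ->
  slice z t i = z (bump j i) + (if i == j then z j - t else 0).
Proof.
move=> zd zt; rewrite (slice_inE _ zd zt) /bump; case: ltngtP => [ij|ij|->].
- by rewrite add0n addr0.
- by rewrite add1n addr0.
- by rewrite add1n; ring.
Qed.

(** The linear form of a word on the slices is affine on [z j.+1, z j], and by
    [weightS] it interpolates between two consecutive insertion positions. *)
Lemma sum_slice_weight n z a (u : nat -> R) t j : (forall i, z i.+1 <= z i) ->
  z j.+1 <= t <= z j -> (j < n)%N ->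
  a * t + \sum_(i < n) slice z t i * u i =
  weight n z a u j + (t - z j) * (a - u j).
Proof.
move=> zd zt jn; under eq_bigr do rewrite (slice_bump _ zd zt) mulrDl.
rewrite big_split/= [X in _ + (_ + X)](bigD1 (Ordinal jn))//= eqxx.
rewrite [X in _ + (_ + (_ + X))]big1 => [|i ij].
  by rewrite /weight; ring.
by rewrite -val_eqE/= in ij; rewrite (negbTE ij) mul0r.
Qed.

Lemma deriv_linear_exp (a b k : R) n :
  (k *: (a *: 'X + b%:P) ^+ n.+1)^`() =
  (k * a * n.+1%:R) *: (a *: 'X + b%:P) ^+ n.
Proof.
rewrite derivZ deriv_exp derivD derivC addr0 derivZ derivX/=.
by rewrite -!mul_polyC -mulr_natr !polyCM -polyC_natr; ring.
Qed.

(** The translation and the parameters are universally quantified, so the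
    induction hypothesis can be used with a translation that depends on the
    slice. *)
Lemma volume_polymatroid m z c (lam : 'I_m.+1 -> R) :
  (forall i, z i.+1 <= z i) -> (forall i, 0 <= z i) -> injective lam ->
  lebesgue_tuple m [set t | polymatroid z (tnth t)] =
  ((m`!%:R)^-1 * perm_sum z c lam)%:E.
Proof.
elim: m z c lam => [|m IH] z c lam zd z0 lam_inj.
  rewrite /= diracE mem_set; last first.
    split=> [[]//|b]; by rewrite !big_ord0.
  rewrite /perm_sum (eq_bigr (fun=> 1)) => [|s _].
    by rewrite sumr_const card_Sn fact0 invr1 mul1r.
  by rewrite expr0 /chain big_ord0 divr1.
(* only the first m.+1 entries matter, so the next ones may be taken to be 0 *)
wlog zm : z zd z0 / z m.+1 = 0.
  move=> wlg; pose z' k := if (k < m.+1)%N then z k else 0.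
  have zz' k : (k < m.+1)%N -> z k = z' k by rewrite /z' => ->.
  have z'z k : (k < m.+1)%N -> z' k = z k by rewrite /z' => ->.
  rewrite (eq_perm_sum _ _ zz') -wlg.
  - congr (lebesgue_tuple _ _); apply/seteqP.
    by split=> t; exact: eq_polymatroid.
  - move=> i; rewrite /z'; case: ifP => [im|_]; last by case: ifP.
    by rewrite ltnW.
  - by move=> i; rewrite /z'; case: ifP.
  - by rewrite /z' ltnn.
set a := lam ord0; pose lam' := lam \o lift ord0.
have lam'_inj : injective lam' by move=> i j /lam_inj/lift_inj.
pose w s := word lam' s; pose u s := stop (last_pos s) (w s).
have uE (s : 'S_m.+1) : u s m = lam ord_max.
  rewrite /u /stop (minn_idPr (last_pos_lt s)) /w /word /lam'/=.
  rewrite /last_pos inord_val permKV; congr lam; exact/val_inj.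
have au s k : a - u s k != 0.
  rewrite subr_eq0; apply/eqP => /lam_inj/eqP.
  by rewrite (negbTE (neq_lift _ _)).
pose A s := weight m.+1 z a (u s).
(* [lin s j] is the affine function of [t] that the word [w s] contributes on
   the interval of index [j], and [q j] a primitive of the slice volume there *)
pose f := (m.+1`!%:R : R)^-1.
pose lin s j : {poly R} :=
  (a - u s j) *: 'X + (c + A s j - z j * (a - u s j))%:P.
pose q j : {poly R} := \sum_(s : 'S_m.+1)
  (f / (a - u s j) / chain m (w s)) *: lin s j ^+ m.+1.
(* the merged sequence has one entry more than the slice has coordinates; the
   translation restores its contribution, which [uE] attributes to the special
   letter *)
pose G t := (m`!%:R)^-1 *
  perm_sum (slice z t) (c + a * t + slice z t m * lam ord_max) lam'.
have linE s j t : (lin s j).[t] = c + A s j + (t - z j) * (a - u s j).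
  by rewrite /lin !hornerE/=; ring.
have volE t : lebesgue_tuple m
    [set y | polymatroid z (tnth (tuple_of_pair (t, y)))] =
    ((EFin \o G) \_ `[z m.+1, z 0%N]%classic) t.
  rewrite /patch; case: ifPn; rewrite zm.
    rewrite inE/= in_itv/= => tz.
    rewrite -IH//; first last.
    - by move=> i; apply: slice_ge0 => //; case/andP: tz.
    - by move=> i; exact: slice_decr.
    congr (lebesgue_tuple m _); apply/seteqP; split=> y/=.
      move=> /(polymatroid_slice _ z0)[_]; rewrite tnth0.
      by congr polymatroid; apply/funext => i/=; rewrite tnthS.
    move=> Py; apply/polymatroid_slice => //; rewrite tnth0; split=> //.
    by move: Py; congr polymatroid; apply/funext => i/=; rewrite tnthS.
  move=> tz; rewrite (_ : [set y | _] = set0) ?measure0//.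
  apply/seteqP; split=> y//= /(polymatroid_slice _ z0)[]; rewrite tnth0 => tz'.
  by move: tz; rewrite notin_setE/= in_itv/= tz'.
rewrite lebesgue_tupleS.
under eq_integral => t _ do rewrite volE.
rewrite -integral_mkcond.
have [|_ /= ->] := @integral_pieces G z q m.+1 zd.
  move=> j t jm zt; rewrite /G /perm_sum /q raddf_sum/= horner_sum mulr_sumr.
  apply: eq_bigr => s _; rewrite deriv_linear_exp hornerZ horner_exp.
  rewrite -/(lin s j) linE.
  have -> : c + a * t + slice z t m * lam ord_max +
      \sum_(i < m) slice z t i * stop (last_pos s) (word lam' s) i =
      c + A s j + (t - z j) * (a - u s j).
    rewrite -[RHS]addrA -sum_slice_weight// big_ord_recr/= uE.
    by rewrite /u /w; ring.
  rewrite /f factS natrM invfM.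
  have mf : (m`!%:R : R) != 0 by rewrite pnatr_eq0 -lt0n fact_gt0.
  have m1 : (m.+1%:R : R) != 0 by rewrite pnatr_eq0.
  have [->|cw] := eqVneq (chain m (w s)) 0.
    by rewrite !(invr0, mulr0, mul0r).
  by field; rewrite nat1r m1 mf au cw.
congr EFin; rewrite perm_sumS// mulr_sumr.
under eq_bigr do rewrite /q !horner_sum -sumrB.
rewrite exchange_big/=; apply: eq_bigr => s _.
rewrite -/lam' -/(w s) -/(u s) -/(A s) mulr_suml mulr_sumr.
apply: eq_bigr => j _; rewrite !hornerZ !horner_exp !linE subrr mul0r addr0.
rewrite -addrA -weightS// -/(A s) -/f; ring.
Qed.

End volume.

(** * Extension of the parameters *)

Lemma chain_neq0 (F : fieldType) m (lam : 'I_m.+1 -> F) s : injective lam ->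
  chain m (word lam s) != 0.
Proof.
move=> lam_inj; apply/prodf_neq0 => i _; rewrite subr_eq0; apply/eqP.
by move/(word_inj lam_inj (ltnW (ltn_ord i)) (ltn_ord i))/eqP; rewrite ltn_eqF.
Qed.

(** After clearing denominators, a polynomial with infinitely many roots. *)
Lemma rat_sum_const (F : fieldType) (I : finType) (N D : I -> {poly F})
    (v x : F) :
  (forall n, exists2 ys : seq F, uniq ys /\ (n <= size ys)%N &
     forall y, y \in ys -> (forall i, (D i).[y] != 0) /\
       \sum_i (N i).[y] / (D i).[y] = v) ->
  (forall i, (D i).[x] != 0) -> \sum_i (N i).[x] / (D i).[x] = v.
Proof.
move=> Hys Dx.
pose P := \sum_i N i * (\prod_(j | j != i) D j) - v%:P * \prod_i D i.
have PE y : (forall i, (D i).[y] != 0) ->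
    P.[y] = (\prod_i (D i).[y]) * (\sum_i (N i).[y] / (D i).[y] - v).
  move=> Dy; rewrite /P hornerD hornerN hornerM hornerC horner_sum.
  rewrite horner_prod mulrBr [v * _]mulrC; congr (_ - _).
  rewrite mulr_sumr; apply: eq_bigr => i _.
  rewrite hornerM horner_prod [in RHS](bigD1 i)//=.
  by field; exact: Dy.
have P0 : P = 0.
  have [ys [ysu ysn] ysP] := Hys (size P).
  apply: (roots_geq_poly_eq0 _ ysu ysn); apply/allP => y /ysP[Dy sy].
  by rewrite /root PE// sy subrr mulr0.
have := PE _ Dx; rewrite P0 horner0 => /esym/eqP.
rewrite mulf_eq0 subr_eq0 => /orP[|/eqP//].
by rewrite prodf_seq_eq0 => /hasP[i _ /=]; rewrite (negbTE (Dx i)).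
Qed.

Lemma rmorph_perm_sum (R F : fieldType) (iota : {rmorphism R -> F}) m z c
    (lam : 'I_m.+1 -> R) :
  iota (perm_sum z c lam) = perm_sum (iota \o z) (iota c) (iota \o lam).
Proof.
rewrite rmorph_sum; apply: eq_bigr => s _.
rewrite rmorphM fmorphV rmorphXn rmorphD rmorph_sum rmorph_prod.
congr ((_ + _) ^+ _ / _).
  by apply: eq_bigr => i _; rewrite rmorphM.
by apply: eq_bigr => i _; rewrite rmorphB.
Qed.

(** By induction on the number [k] of initial parameters allowed to lie outside
    the image of [iota]. *)
Lemma perm_sum_transfer (R : numFieldType) (F : fieldType)
    (iota : {rmorphism R -> F}) m (z : nat -> R) (c v : R) :
  (forall lam : 'I_m.+1 -> R, injective lam -> perm_sum z c lam = v) ->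
  forall lam : 'I_m.+1 -> F, injective lam ->
    perm_sum (iota \o z) (iota c) lam = iota v.
Proof.
move=> H.
suff Hk k (lam : 'I_m.+1 -> F) : injective lam ->
    (forall i : 'I_m.+1, (k <= i)%N -> exists x, lam i = iota x) ->
    perm_sum (iota \o z) (iota c) lam = iota v.
  by move=> lam lam_inj; apply: (Hk m.+1) => // i; rewrite leqNgt ltn_ord.
elim: k lam => [|k IH] lam lam_inj lamk.
  have /choice[lam' lam'E] : forall i, exists x, lam i = iota x.
    by move=> i; exact: lamk.
  have -> : lam = iota \o lam' by apply/funext => i; exact: lam'E.
  by rewrite -rmorph_perm_sum H// => i j ij; apply: lam_inj; rewrite !lam'E ij.
have [km|mk] := ltnP k m.+1; last first.
  by apply: IH => // i ki; have := leq_trans mk ki; rewrite leqNgt ltn_ord.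
pose i0 := Ordinal km.
pose lamy y i := if i == i0 then y else lam i.
pose lamP i : {poly F} := if i == i0 then 'X else (lam i)%:P.
have lamPE y i : (lamP i).[y] = lamy y i.
  by rewrite /lamP /lamy; case: ifP => _; rewrite ?hornerX ?hornerC.
have lamx : lamy (lam i0) = lam.
  by apply/funext => i; rewrite /lamy; case: eqP => [->|].
pose N (s : 'S_m.+1) : {poly F} := ((iota c)%:P +
  \sum_(i < m) (iota (z i))%:P * stop (last_pos s) (word lamP s) i) ^+ m.
pose D (s : 'S_m.+1) : {poly F} := chain m (word lamP s).
have NE s y : (N s).[y] = (iota c + \sum_(i < m)
    (iota \o z) i * stop (last_pos s) (word (lamy y) s) i) ^+ m.
  rewrite /N horner_exp hornerD hornerC horner_sum; congr ((_ + _) ^+ _).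
  by apply: eq_bigr => i _; rewrite hornerM hornerC /stop /word lamPE.
have DE s y : (D s).[y] = chain m (word (lamy y) s).
  rewrite /D /chain horner_prod; apply: eq_bigr => i _.
  by rewrite hornerD hornerN /word !lamPE.
have sumE y : perm_sum (iota \o z) (iota c) (lamy y) =
    \sum_s (N s).[y] / (D s).[y].
  by apply: eq_bigr => s _; rewrite NE DE.
rewrite -lamx sumE; apply: rat_sum_const => [n|s]; last first.
  by rewrite DE lamx; exact: chain_neq0.
(* the values already taken by the other parameters must be avoided *)
pose ys := [seq iota j%:R | j <- seq.iota 0 (n + m.+1)].
have ysu : uniq ys.
  rewrite map_inj_uniq ?iota_uniq// => i j /fmorph_inj/eqP.
  by rewrite eqr_nat => /eqP.
exists [seq y <- ys | y \notin codom lam].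
  split; first exact: filter_uniq.
  rewrite size_filter -(leq_add2r m.+1).
  have <- : size ys = (n + m.+1)%N by rewrite size_map size_iota.
  rewrite -(count_predC (mem (codom lam))) addnC leq_add2l.
  rewrite -size_filter -[X in (_ <= X)%N]card_ord -(size_codom lam).
  apply: uniq_leq_size; first exact: filter_uniq.
  by move=> y; rewrite mem_filter => /andP[].
move=> y; rewrite mem_filter => /andP[ylam /mapP[j _ yj]].
have lamy_inj : injective (lamy y).
  have ylam' i : y != lam i.
    by apply: contraNneq ylam => ->; exact: codom_f.
  move=> i i'; rewrite /lamy; case: eqP => [->|_]; case: eqP => [->|_]//.
  - by move/eqP; rewrite (negbTE (ylam' _)).
  - by move/eqP; rewrite eq_sym (negbTE (ylam' _)).
  - exact: lam_inj.
split=> [s|]; first by rewrite DE; exact: chain_neq0.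
rewrite -sumE; apply: IH => // i ki; rewrite /lamy; case: eqP => [_|/eqP ii0].
  by exists j%:R.
by apply: lamk; rewrite ltn_neqAle ki andbT eq_sym.
Qed.

(** * The volume formula *)

Lemma sum_arith (F : fieldType) (x : F) p m : (2%:R : F) != 0 -> (p <= m)%N ->
  \sum_(i < m | ~~ (i < p)%N) (x - i%:R) =
  1 / 2%:R * (m%:R - p%:R) * (2%:R * x - m%:R - p%:R + 1).
Proof.
move=> F2 /subnKC <-; elim: (m - p)%N => [|k IH].
  rewrite addn0 big1 ?subrr; first by rewrite mulr0 mul0r.
  by move=> i; rewrite ltn_ord.
rewrite addnS big_mkcond big_ord_recr -big_mkcond/= IH -leqNgt leq_addr.
by rewrite -addn1 !natrD; field.
Qed.

Theorem mainTheorem13 (R : realType) (F : fieldType) (iota : {rmorphism R -> F})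
    (m n : nat) (lam : 'I_m.+1 -> F) :
  (0 < m)%N -> (0 < n)%N -> (m - 1 <= n)%N -> injective lam ->
  iota (normalized_volume R m n) =
  \sum_(s : 'S_m.+1)
    let p := ((s^-1)%g ord_max).+1 in
    (\sum_(i < m.+1 | (i.+1 <= p - 1)%N)
        (n%:R - i.+1%:R + 1) * lam (s i) +
     1 / 2%:R * (m%:R - p%:R + 1) * (2%:R * n%:R - m%:R - p%:R + 2%:R) *
        lam ord_max) ^+ m /
    \prod_(i < m) (lam (s (widen_ord (leqnSn m) i)) - lam (s (lift ord0 i))).
Proof.
move=> _ _ mn lam_inj.
pose z k : R := (n - k)%N%:R.
have volE (mu : 'I_m.+1 -> R) : injective mu ->
    perm_sum z 0 mu = normalized_volume R m n.
  move=> mu_inj; rewrite /normalized_volume /volume partial_permutohedronE/=.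
  have -> : [set t | polymatroid z ((\row_i tnth t i : 'rV[R]_m) 0)]%classic =
      [set t : m.-tuple (measurableTypeR R) | polymatroid z (tnth t)]%classic.
    apply/seteqP; split=> t /=; congr polymatroid;
      by apply/funext => i; rewrite mxE.
  rewrite (volume_polymatroid 0 _ _ mu_inj).
  - by rewrite /= mulrA mulfV ?mul1r// pnatr_eq0 -lt0n fact_gt0.
  - by move=> i; rewrite ler_nat; lia.
  - by [].
rewrite -(perm_sum_transfer iota volE lam_inj); apply: eq_bigr => s _ /=.
have pm := last_pos_lt s; rewrite -/(last_pos s); set p := last_pos s in pm *.
have F2 : (2%:R : F) != 0 by rewrite -(rmorph_nat iota) fmorph_eq0 pnatr_eq0.
congr (_ ^+ _ / _); last first.
  apply: eq_bigr => i _; rewrite /word; congr (lam (s _) - lam (s _)).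
    by apply/val_inj; rewrite /= inordK// ltnW// ltnS.
  by apply/val_inj; rewrite /= inordK// ltnS.
rewrite rmorph0 add0r (bigID (fun i : 'I_m => (i < p)%N))/=; congr (_ + _).
  rewrite [RHS]big_mkcond big_ord_recr/= -big_mkcond/= subn1/= ltnNge pm addr0.
  apply: eq_bigr => i ip.
  rewrite rmorph_nat natrB; last by have := ltn_ord i; lia.
  rewrite /stop (minn_idPl (ltnW ip)) /word -natr1; congr (_ * lam (s _)).
    by ring.
  by apply/val_inj; rewrite /= inordK// ltnW// ltnS.
rewrite (eq_bigr (fun i : 'I_m => (n%:R - i%:R) * lam ord_max)) => [|i].
  rewrite -mulr_suml sum_arith//; congr (_ * _).
  by rewrite -!natr1; ring.
rewrite -leqNgt => p_le_i; rewrite rmorph_nat natrB; last by have := ltn_ord i; lia.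
by rewrite /stop (minn_idPr p_le_i) /word /p inord_val permKV.
Qed.
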